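(* Let $p\in\mathbb{N}$, $\beta>0$, $\alpha>(p-1)/2$, and let $\boldsymbol{\Sigma}$ be a $p\times p$ positive definite matrix. Let $\boldsymbol{\mathcal{X}}_1,\dots,\boldsymbol{\mathcal{X}}_n$ be i.i.d. random positive definite $p\times p$ matrices with the matrix gamma pdf $$f(\boldsymbol{x})=\frac{|\boldsymbol{\Sigma}|^{-\alpha}}{\beta^{p\alpha}\Gamma_p(\alpha)}|\boldsymbol{x}|^{\alpha-(p+1)/2}\exp\Big(-\frac1\beta\,\mathrm{tr}(\boldsymbol{\Sigma}^{-1}\boldsymbol{x})\Big),$$ $\overline{\boldsymbol{\mathcal{X}}}_n=\frac1n\sum_{\ell=1}^n\boldsymbol{\mathcal{X}}_\ell$ and $\boldsymbol{\mu}=\alpha\beta\boldsymbol{\Sigma}$. Then for positive definite $\boldsymbol{z}$, $$\Pr\{\overline{\boldsymbol{\mathcal{X}}}_n\succ\boldsymbol{z}\}\le\Big[\Big(\frac e{\alpha\beta}\Big)^{p\alpha}\Big(\frac{|\boldsymbol{z}|}{|\boldsymbol{\Sigma}|}\Big)^\alpha\exp\Big(-\frac1\beta\mathrm{tr}(\boldsymbol{\Sigma}^{-1}\boldsymbol{z})\Big)\Big]^n\quad\text{for }\boldsymbol{z}\succ\boldsymbol{\mu},$$ $$\Pr\{\overline{\boldsymbol{\mathcal{X}}}_n\prec\boldsymbol{z}\}\le\Big[\Big(\frac e{\alpha\beta}\Big)^{p\alpha}\Big(\frac{|\boldsymbol{z}|}{|\boldsymbol{\Sigma}|}\Big)^\alpha\exp\Big(-\frac1\beta\mathrm{tr}(\boldsymbol{\Sigma}^{-1}\boldsymbol{z})\Big)\Big]^n\quad\text{for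 }\boldsymbol{z}\prec\boldsymbol{\mu}.$$ In particular, $\Pr\{\overline{\boldsymbol{\mathcal{X}}}_n\succ\varrho\boldsymbol{\mu}\}\le[\varrho\exp(1-\varrho)]^{np\alpha}$ for $\varrho\ge1$, and $\Pr\{\overline{\boldsymbol{\mathcal{X}}}_n\prec\varrho\boldsymbol{\mu}\}\le[\varrho\exp(1-\varrho)]^{np\alpha}$ for $0\le\varrho\le1$.
   Context: $|\cdot|$ denotes the determinant, $\mathrm{tr}$ the trace, and $\Gamma_p$ the multivariate gamma function. For symmetric matrices, $\boldsymbol{x}\prec\boldsymbol{y}$ means $\boldsymbol{y}-\boldsymbol{x}$ is positive definite, and $\boldsymbol{x}\succ\boldsymbol{y}$ means $\boldsymbol{x}-\boldsymbol{y}$ is positive definite. *)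

(* Defs.v *)
From HB Require Import structures.
From mathcomp Require Import all_boot all_order all_algebra.
From mathcomp Require Import all_classical all_reals all_analysis.
Set Implicit Arguments. Unset Strict Implicit. Unset Printing Implicit Defensive.
Import Order.TTheory GRing.Theory Num.Theory.
Import numFieldNormedType.Exports.
Local Open Scope classical_set_scope.
Local Open Scope ring_scope.

Section MatrixGamma.
Variable R : realType.

Definition posdef (p : nat) (M : 'M[R]_p) : Prop :=
  M^T = M /\ forall v : 'rV[R]_p, v != 0 -> 0 < (v *m M *m v^T) 0 0.

Definition mx_succ (p : nat) (x y : 'M[R]_p) : Prop := posdef (x - y).
Definition mx_prec (p : nat) (x y : 'M[R]_p) : Prop := posdef (y - x).

(* sigma-algebra on p x p matrices generated by the entries (Borel) *)
Definition mx_coord (p : nat) (k : 'I_#|{: 'I_p * 'I_p}|) (M : 'M[R]_p) : R :=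
  M (enum_val k).1 (enum_val k).2.
Definition mx_measurable (p : nat) : set (set 'M[R]_p) :=
  g_sigma_preimage (@mx_coord p).

Definition Gamma (a : R) : R :=
  fine (\int[@lebesgue_measure R]_(x in `]0%R, +oo[%classic)
          (powR x (a - 1) * expR (- x))%:E)%E.

Definition mGamma (p : nat) (a : R) : R :=
  powR pi ((p * p.-1)%:R / 4) * \prod_(j < p) Gamma (a - j%:R / 2).

(* Lebesgue measure on symmetric matrices: iterated Lebesgue integral over
   the p(p+1)/2 upper-triangular entries (i <= j) *)
Definition upd (p : nat) (c : 'I_p * 'I_p -> R) (ij : 'I_p * 'I_p) (t : R) :=
  fun k => if k == ij then t else c k.
Fixpoint iint (p : nat) (s : seq ('I_p * 'I_p))
    (F : ('I_p * 'I_p -> R) -> \bar R) (c : 'I_p * 'I_p -> R) : \bar R :=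
  match s with
  | [::] => F c
  | ij :: s' => (\int[@lebesgue_measure R]_t iint s' F (upd c ij t))%E
  end.
Definition upper_idx (p : nat) : seq ('I_p * 'I_p) :=
  [seq ij <- enum {: 'I_p * 'I_p} | ((ij : 'I_p * 'I_p).1 <= ij.2)%N].
Definition symmx (p : nat) (c : 'I_p * 'I_p -> R) : 'M[R]_p :=
  \matrix_(i, j) (if (i <= j)%N then c (i, j) else c (j, i)).
Definition sym_integral (p : nat) (F : 'M[R]_p -> \bar R) : \bar R :=
  iint (upper_idx p) (fun c => F (symmx c)) (fun _ => 0).

Definition mgamma_pdf (p : nat) (alpha beta : R) (Sigma : 'M[R]_p)
    (x : 'M[R]_p) : R :=
  \1_[set y | posdef y] x *
  (powR (\det Sigma) (- alpha) / (powR beta (p%:R * alpha) * mGamma p alpha) *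
   powR (\det x) (alpha - (p.+1)%:R / 2) *
   expR (- (beta^-1 * \tr (invmx Sigma *m x)))).

Definition has_mx_pdf d (T : measurableType d) (P : probability T R)
    (p : nat) (X : T -> 'M[R]_p) (f : 'M[R]_p -> R) : Prop :=
  (forall A, mx_measurable A -> measurable (X @^-1` A)) /\
  forall A, mx_measurable A ->
    P (X @^-1` A) = sym_integral (fun x => (\1_A x * f x)%:E).

Definition mx_indep d (T : measurableType d) (P : probability T R)
    (p n : nat) (X : 'I_n -> T -> 'M[R]_p) : Prop :=
  forall A : 'I_n -> set 'M[R]_p, (forall l, mx_measurable (A l)) ->
    P (\bigcap_(l in [set: 'I_n]) (X l @^-1` A l)) =
    (\prod_(l < n) P (X l @^-1` A l))%E.

Definition mx_mean (T : Type) (p n : nat) (X : 'I_n -> T -> 'M[R]_p) (t : T)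
  : 'M[R]_p := n%:R^-1 *: \sum_(l < n) X l t.

End MatrixGamma.

(* Main.v *)
Require Import Defs.
From HB Require Import structures.
From mathcomp Require Import all_boot all_order all_algebra finmap.
From mathcomp Require Import all_classical all_reals all_analysis.
From mathcomp Require Import measurable_realfun ring lra zify.
Set Implicit Arguments. Unset Strict Implicit. Unset Printing Implicit Defensive.
Import Order.TTheory GRing.Theory Num.Theory.
Import numFieldNormedType.Exports.
Local Open Scope classical_set_scope.
Local Open Scope ring_scope.

(* Chernoff's method.  With S = Sigma^-1 / beta - alpha z^-1, either event forces
   tr (S Xbar) >= tr (S z), because S is semidefinite of the right sign (matrix
   inversion is antitone) and the trace of a product of semidefinite matrices is
   nonnegative.  By Markov's inequality and independence the probability is at
   most (exp (- tr (S z)) E exp (tr (S X)))^n.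

   Tilting the density by exp (tr (S x)) replaces B0 = Sigma^-1 / beta by
   B = alpha z^-1 in the exponent.  Cholesky factors give a lower triangular L
   with L^T B L = B0, and substituting x = L y L^T turns the tilted integral into
   (det B0 / det B)^alpha times the integral of the density itself, which is 1.
   Hence the value of the normalising constant is never needed.

   The iterated integrals are handled without measurability or Tonelli: the
   integral of an arbitrary nonnegative function is the supremum of the integrals
   of the simple functions below it, which is monotone, superadditive and
   well-behaved under affine substitutions, and only upper bounds are needed. *)

(** * Integrals of arbitrary nonnegative functions *)

Section lower_integral.
Local Open Scope ereal_scope.
Context d (T : measurableType d) (R : realType).
Variable mu : {measure set T -> \bar R}.
Implicit Types f g : T -> \bar R.

Import HBNNSimple.

Lemma sintegral_le_integral f (h : {nnsfun T >-> R}) :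
  (forall x, 0 <= f x) -> (forall x, (h x)%:E <= f x) ->
  sintegral mu h <= \int[mu]_x f x.
Proof.
by move=> f0 hf; rewrite ge0_integralTE//; apply: ereal_sup_ubound; exists h.
Qed.

Lemma integral_le_sintegral f (M : \bar R) :
  (forall x, 0 <= f x) ->
  (forall h : {nnsfun T >-> R}, (forall x, (h x)%:E <= f x) ->
     sintegral mu h <= M) ->
  \int[mu]_x f x <= M.
Proof.
move=> f0 hM; rewrite ge0_integralTE//; apply: ge_ereal_sup => _ [h /= hf <-].
exact: hM.
Qed.

Lemma ge0_le_lower_integral f g : (forall x, 0 <= f x) ->
  (forall x, f x <= g x) -> \int[mu]_x f x <= \int[mu]_x g x.
Proof.
move=> f0 fg; apply: integral_le_sintegral => // h hf.
apply: sintegral_le_integral => x; first exact: le_trans (fg x).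
exact: le_trans (fg x).
Qed.

(** Simple functions below [f] and below [g] add up to one below [f + g]. The subtractions need
    finite integrals, so an infinite right-hand side is settled first. *)
Lemma ge0_lower_integralD f g : (forall x, 0 <= f x) -> (forall x, 0 <= g x) ->
  \int[mu]_x f x + \int[mu]_x g x <= \int[mu]_x (f x + g x).
Proof.
move=> f0 g0; have fg0 x : 0 <= f x + g x by exact: adde_ge0.
have := leey (\int[mu]_x (f x + g x)).
rewrite le_eqVlt => /predU1P[->|fgoo]; first by rewrite leey.
have gfin : \int[mu]_x g x \is a fin_num.
  rewrite ge0_fin_numE ?integral_ge0//; apply: le_lt_trans fgoo.
  by apply: ge0_le_lower_integral => // x; rewrite leeDr.
rewrite -leeBrDr//; apply: integral_le_sintegral => // h hf.
have hfin : sintegral mu h \is a fin_num.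
  rewrite ge0_fin_numE ?sintegral_ge0//; apply: le_lt_trans fgoo.
  apply: sintegral_le_integral => // x; apply: le_trans (hf x) _.
  by rewrite leeDl.
rewrite leeBrDr// addeC -leeBrDr//.
apply: integral_le_sintegral => // k kg; rewrite leeBrDr// addeC.
rewrite -sintegralD; apply: (@sintegral_le_integral _ (add_nnsfun h k)) => // x.
by rewrite /= EFinD leeD.
Qed.

Lemma ge0_lower_integralZl f (k : R) : (forall x, 0 <= f x) -> (0 <= k)%R ->
  k%:E * \int[mu]_x f x <= \int[mu]_x (k%:E * f x).
Proof.
move=> f0; rewrite le_eqVlt => /predU1P[<-|k0].
  by rewrite mul0e integral_ge0// => x _; rewrite mul0e.
have kf0 x : 0 <= k%:E * f x by rewrite mule_ge0// lee_fin ltW.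
rewrite -lee_pdivlMl//; apply: integral_le_sintegral => // h hf.
rewrite lee_pdivlMl// -sintegralrM.
apply: (@sintegral_le_integral _ (scale_nnsfun h (ltW k0))) => // x.
by rewrite /= EFinM lee_pmul2l// lte_fin.
Qed.

End lower_integral.

(** * Affine change of variable on the real line *)

Section affine_substitution.
Local Open Scope ereal_scope.
Context {R : realType}.
Local Notation mu := (@lebesgue_measure R).
Variables (a b : R) (a0 : (0 < a)%R).
Let phi : measurableTypeR R -> measurableTypeR R := fun t => (a * t + b)%R.

Let mphi : measurable_fun setT phi.
Proof. by apply: measurable_funD => //; exact: measurable_funM. Qed.

Lemma lebesgue_measure_affine (A : set R) : measurable A ->
  mu A = a%:E * mu (phi @^-1` A).
Proof.
move=> mA; pose ma := NngNum (ltW a0).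
have -> : a%:E * mu (phi @^-1` A) = mscale ma (pushforward mu phi) A by [].
pose mixin := isMeasurableFun.Build _ _ _ _ _ mphi.
pose psi : {mfun measurableTypeR R >-> measurableTypeR R} := HB.pack phi mixin.
apply: (@lebesgue_measure_unique R
  (mscale ma (pushforward mu psi))) => //= _ [[u v]] _ <-.
rewrite /mscale/= /pushforward.
have -> : phi @^-1` `]u, v] = `]((u - b) / a)%R, ((v - b) / a)%R]%classic.
  apply/seteqP; split => t /=; rewrite !in_itv/= /phi.
    by rewrite ltr_pdivrMr// ler_pdivlMr// ltrBlDr lerBrDr mulrC.
  by rewrite ltr_pdivrMr// ler_pdivlMr// ltrBlDr lerBrDr [(t * a)%R]mulrC.
rewrite !lebesgue_measure_itv/= !lte_fin ltr_pM2r ?invr_gt0// ltrD2r.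
case: ifPn => _; last by rewrite mule0.
by rewrite -!EFinD -EFinM; congr EFin; field; rewrite gt_eqF.
Qed.

Import HBNNSimple.

(** Transfer to an image measure is for measurable functions, so it is applied to each simple [h]
    below [f]; after the substitution [h] still lies below [f]. *)
Lemma ge0_lower_integral_affine (f : R -> \bar R) : (forall x, 0 <= f x) ->
  \int[mu]_x f x <= a%:E * \int[mu]_x f (a * x + b)%R.
Proof.
move=> f0; apply: integral_le_sintegral => // h hf; rewrite -integralT_nnsfun.
have mh : measurable_fun [set: measurableTypeR R] (EFin \o h).
  by apply/measurable_EFinP; exact: measurable_funPT.
pose ma := NngNum (ltW a0).
pose mixin := isMeasurableFun.Build _ _ _ _ _ mphi.
pose psi : {mfun measurableTypeR R >-> measurableTypeR R} := HB.pack phi mixin.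
rewrite (@eq_measure_integral _ _ _ _ (mscale ma (pushforward mu psi))); last first.
  by move=> A mA _; exact: lebesgue_measure_affine.
rewrite ge0_integral_mscale//; last by move=> x _; rewrite lee_fin.
rewrite ge0_integral_pushforward//; last by move=> x _; rewrite /= lee_fin.
rewrite lee_wpmul2l ?lee_fin ?(ltW a0)// preimage_setT.
apply: ge0_le_lower_integral => x; [by rewrite /= lee_fin|exact: hf].
Qed.

End affine_substitution.

(** * Iterated integrals and the substitution x = L y L^T *)

Section iterated_integral.
Local Open Scope ereal_scope.
Context (R : realType) (p : nat).
Implicit Types (s : seq ('I_p * 'I_p)) (F G : ('I_p * 'I_p -> R) -> \bar R).

Lemma iint_ge0 s F c : (forall c, 0 <= F c) -> 0 <= iint s F c.
Proof. by move=> F0; elim: s c => //= k s IH c; exact: integral_ge0. Qed.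

Lemma ge0_le_iint s F G c : (forall c, 0 <= F c) -> (forall c, F c <= G c) ->
  iint s F c <= iint s G c.
Proof.
move=> F0 FG; elim: s c => //= k s IH c.
by apply: ge0_le_lower_integral => // t; exact: iint_ge0.
Qed.

Lemma ge0_iintD s F G c : (forall c, 0 <= F c) -> (forall c, 0 <= G c) ->
  iint s F c + iint s G c <= iint s (fun c => F c + G c) c.
Proof.
move=> F0 G0; elim: s c => //= k s IH c.
apply: le_trans (ge0_lower_integralD _ _ _) _ => [t|t|]; try exact: iint_ge0.
by apply: ge0_le_lower_integral => // t; rewrite adde_ge0 ?iint_ge0.
Qed.

Lemma ge0_iintZl s F (k : R) c : (forall c, 0 <= F c) -> (0 <= k)%R ->
  k%:E * iint s F c <= iint s (fun c => k%:E * F c) c.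
Proof.
move=> F0 k0; elim: s c => //= ij s IH c.
apply: le_trans (ge0_lower_integralZl _ _ _) _ => // [t|]; first exact: iint_ge0.
by apply: ge0_le_lower_integral => // t; rewrite mule_ge0 ?iint_ge0.
Qed.

Lemma ge0_iint_sum (I : Type) (r : seq I) s
    (F : I -> ('I_p * 'I_p -> R) -> \bar R) c :
  (forall i c, 0 <= F i c) ->
  \sum_(i <- r) iint s (F i) c <= iint s (fun c => \sum_(i <- r) F i c) c.
Proof.
move=> F0; elim: r => [|i r IH].
  by rewrite big_nil; apply: iint_ge0 => c'; rewrite big_nil.
rewrite big_cons.
have -> : (fun c => \sum_(j <- i :: r) F j c) =
    (fun c => F i c + \sum_(j <- r) F j c).
  by apply/funext => c'; rewrite big_cons.
apply: le_trans (ge0_iintD _ _ _ _) => //; first by rewrite leeD2l.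
by move=> c'; exact: sume_ge0.
Qed.

End iterated_integral.

(** * Order in which the upper-triangular entries are integrated *)

Section upper_idx_order.
Variable p : nat.

Definition lex_lt (k m : 'I_p * 'I_p) : bool :=
  (k.1 < m.1)%N || ((k.1 == m.1) && (k.2 < m.2)%N).

(** A product type is enumerated row by row, and filtering preserves the order. *)
Lemma pairwise_upper_idx : pairwise lex_lt (upper_idx p).
Proof.
suff : pairwise lex_lt (enum {: 'I_p * 'I_p}).
  by apply: (subseq_pairwise (filter_subseq _ _)).
have ltn_enum : pairwise (fun i j : 'I_p => (i < j)%N) (enum 'I_p).
  rewrite -(pairwise_map val (fun i j => (i < j)%N)) val_enum_ord.
  by rewrite -sorted_pairwise ?iota_ltn_sorted//; exact: ltn_trans.
rewrite enumT unlock /= /prod_enum.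
have := ltn_enum; elim: {1 3}(enum 'I_p) => //= i r IH /andP[/allP ir rr].
rewrite pairwise_cat IH// andbT; apply/andP; split.
  apply/allrelP => x y /mapP[j _ ->] /allpairsP[[k l] [/= kr _ ->]].
  by rewrite /lex_lt /= ir.
rewrite pairwise_map; apply: sub_pairwise ltn_enum => j k jk /=.
by rewrite /lex_lt /= eqxx jk orbT.
Qed.

Lemma mem_upper_idx k : (k \in upper_idx p) = (k.1 <= k.2)%N.
Proof. by rewrite mem_filter mem_enum andbT. Qed.

Lemma lex_lt_upper_idx pre k s : upper_idx p = pre ++ k :: s ->
  forall m, m \in pre -> lex_lt m k.
Proof.
have := pairwise_upper_idx => /[swap] ->; rewrite pairwise_cat /=.
by case/and3P => /allrelP + _ _ m mp; apply => //; rewrite mem_head.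
Qed.

End upper_idx_order.

Section congruence_substitution.
Context (R : realType) (p : nat).
Variables (L : 'M[R]_p) (trigL : is_trig_mx L) (diagL : forall i, 0 < L i i).
Implicit Types c : 'I_p * 'I_p -> R.

Definition congr_mx (M : 'M[R]_p) : 'M[R]_p := L *m M *m L^T.

Let E k : 'M[R]_p := symmx (upd (fun=> 0) k 1).

Let symmx_upd c k t : symmx (upd c k t) = symmx (upd c k 0) + t *: E k.
Proof.
apply/matrixP => i j; rewrite !mxE /upd.
by case: ifP => _; case: ifP => _; rewrite ?mulr1 ?add0r ?mulr0 ?addr0.
Qed.

(** In the double sum over [a], [b], triangularity of [L] leaves only [a <= k.1] and [b <= k.2], and
    [E m] is supported at [m] and its transpose. As [k] does not come after [m], a nonzero term
    forces [(a, b) = m = k]. *)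
Let congr_E (k m : 'I_p * 'I_p) : (m.1 <= m.2)%N -> (k.1 <= k.2)%N ->
  (k == m) || lex_lt k m ->
  congr_mx (E m) k.1 k.2 = if k == m then L m.1 m.1 * L m.2 m.2 else 0.
Proof.
case: k m => [k l] [i j] /= ij kl kl_ij.
have L0 (a b : 'I_p) : (a < b)%N -> L a b = 0 by move/is_trig_mxP: trigL; apply.
have term0 (a b : 'I_p) : (a, b) != (i, j) \/ (k, l) != (i, j) ->
    L k a * E (i, j) a b * L l b = 0.
  move=> ne; have [ka|ak] := ltnP k a; first by rewrite L0// !mul0r.
  have [lb|bl] := ltnP l b; first by rewrite [L l b]L0// !mulr0.
  suff -> : E (i, j) a b = 0 by rewrite mulr0 mul0r.
  rewrite mxE /upd; move: kl_ij ne.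
  rewrite /lex_lt !xpair_eqE -!val_eqE /= => kl_ij ne.
  by case: ifP => ab; case: ifP => //; lia.
have -> : congr_mx (E (i, j)) k l =
    \sum_a \sum_b L k a * E (i, j) a b * L l b.
  rewrite mxE; under eq_bigr => b _ do rewrite mxE mulr_suml.
  rewrite exchange_big /=; apply: eq_bigr => a _; apply: eq_bigr => b _.
  by rewrite [L^T _ _]mxE.
case: ifPn => [/eqP[? ?]|ne]; last first.
  by rewrite big1// => a _; rewrite big1// => b _; apply: term0; right.
subst k l; rewrite (bigD1 i)//= (bigD1 j)//= !big1 ?addr0.
- by rewrite mxE /upd ij eqxx mulr1.
- move=> a ai; rewrite big1// => b _; apply: term0; left.
  by rewrite xpair_eqE negb_and ai.
- by move=> b bj; apply: term0; left; rewrite xpair_eqE negb_and bj orbT.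
Qed.

(* The lexicographic order of integration makes the substitution triangular: the
   entry [k] of [L M L^T] is [L k.1 k.1 * L k.2 k.2] times the entry [k] of [M]
   plus a function of the entries integrated further out. *)
Lemma iint_congr_mx s pre c c' (F : 'M[R]_p -> \bar R) :
  (forall M, 0 <= F M)%E ->
  upper_idx p = pre ++ s ->
  (forall k, k \in pre -> c k = congr_mx (symmx c') k.1 k.2) ->
  (iint s (fun c => F (symmx c)) c <=
   (\prod_(k <- s) (L k.1 k.1 * L k.2 k.2))%:E *
   iint s (fun c => F (congr_mx (symmx c))) c')%E.
Proof.
move=> F0; elim: s pre c c' => [|k s IH] pre c c' ups cc' /=.
  rewrite big_nil mul1e; suff -> : symmx c = congr_mx (symmx c') by [].
  have symc : (congr_mx (symmx c'))^T = congr_mx (symmx c').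
    rewrite /congr_mx !trmx_mul trmxK mulmxA; congr (_ *m _ *m _).
    apply/matrixP => i j; rewrite !mxE.
    case: (ltngtP i j) => // /val_inj -> //.
  apply/matrixP => i j; rewrite [LHS]mxE; case: ifPn => ij.
    by rewrite cc'// -[pre]cats0 -ups mem_upper_idx.
  rewrite cc' ?symc//=; first by rewrite -[in RHS]symc [RHS]mxE.
  by rewrite -[pre]cats0 -ups mem_upper_idx /= ltnW// ltnNge.
have k_upper : (k.1 <= k.2)%N.
  by rewrite -mem_upper_idx ups mem_cat mem_head orbT.
pose a := L k.1 k.1 * L k.2 k.2.
have a0 : 0 < a by rewrite mulr_gt0.
(* When the entry [k] of [M] takes the value [t], the entry [k] of [L M L^T] is [a * t + b]. *)
pose b := congr_mx (symmx (upd c' k 0)) k.1 k.2.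
have congrE t m : congr_mx (symmx (upd c' k t)) m.1 m.2 =
    congr_mx (symmx (upd c' k 0)) m.1 m.2 + t * congr_mx (E k) m.1 m.2.
  rewrite symmx_upd /congr_mx mulmxDr mulmxDl -scalemxAr -scalemxAl.
  by rewrite mxE [in X in _ + X = _]mxE.
apply: le_trans (ge0_lower_integral_affine b a0 _) _.
  by move=> t; exact: iint_ge0.
rewrite big_cons -/a [X in (_ <= X * _)%E]EFinM -muleA.
rewrite lee_wpmul2l ?lee_fin ?(ltW a0)//.
set D := \prod_(_ <- _) _; have D0 : 0 <= D.
  by apply: prodr_ge0 => m _; rewrite mulr_ge0 // ltW.
rewrite [X in (_ <= X)%E](_ : _ = D%:E *
  \int[lebesgue_measure]_t iint s (fun c => F (congr_mx (symmx c)))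
     (upd c' k t))%E//.
have step t : (iint s (fun c => F (symmx c)) (upd c k (a * t + b)%R) <=
    D%:E * iint s (fun c => F (congr_mx (symmx c))) (upd c' k t))%E.
  apply: (IH (rcons pre k)); first by rewrite cat_rcons.
  (* The invariant for the longer prefix: at [k] it holds by the choice of [a] and [b]; at the
     earlier entries [E k] contributes nothing, so the value of [t] is irrelevant. *)
  move=> m; rewrite mem_rcons inE; have [-> _|mk /=] := eqVneq m k.
    by rewrite {1}/upd eqxx congrE congr_E// ?eqxx// mulrC addrC.
  move=> mpre; have mk' := lex_lt_upper_idx ups mpre.
  rewrite {1}/upd (negPf mk) cc'//.
  have mup : (m.1 <= m.2)%N by rewrite -mem_upper_idx ups mem_cat mpre.
  have E0 : congr_mx (E k) m.1 m.2 = 0.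
    by rewrite congr_E ?(negPf mk)// mk'.
  rewrite congrE E0 mulr0 addr0.
  have -> : c' = upd c' k (c' k).
    by apply/funext => x; rewrite /upd; case: eqP => // ->.
  rewrite congrE E0 mulr0 addr0; congr (congr_mx (symmx _) _ _).
  by apply/funext => x; rewrite /upd; case: eqP.
apply: (@le_trans _ _ (\int[lebesgue_measure]_t (D%:E *
    iint s (fun c => F (congr_mx (symmx c))) (upd c' k t)))%E).
  by apply: ge0_le_lower_integral => [t|t]; [exact: iint_ge0|exact: step].
(* [ge0_lower_integralZl] only moves a constant into the integral; to take [D] out, it is applied
   with the inverse of [D], hence the case split. *)
have [D00|D_gt0] := leP D 0.
  have -> : D = 0 by apply/eqP; rewrite eq_le D00.
  under eq_integral do rewrite mul0e.
  by rewrite integral0 mul0e.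
rewrite -lee_pdivrMl//.
apply: le_trans (ge0_lower_integralZl _ _ _) _.
- by move=> t; rewrite mule_ge0 ?lee_fin// iint_ge0.
- by rewrite invr_ge0.
under eq_integral do rewrite muleA -EFinM mulVf ?gt_eqF// mul1e.
exact: lexx.
Qed.

(** This is the Jacobian of the substitution. The index [i] is the row of [p - i] pairs and the
    column of [i + 1] pairs, the diagonal pair counting twice, so [L i i] has exponent [p + 1]. *)
Lemma prod_diag_upper_idx :
  \prod_(k <- upper_idx p) (L k.1 k.1 * L k.2 k.2) = (\det L) ^+ p.+1.
Proof.
rewrite det_trig// /upper_idx big_filter big_enum_cond /=.
transitivity (\prod_(i < p) \prod_(j < p)
    (L i i ^+ (i <= j)%N * L j j ^+ (i <= j)%N)).
  rewrite pair_bigA /= big_mkcond /=; apply: eq_bigr => -[i j] _ /=.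
  by case: ifP; rewrite ?expr1// !expr0 mulr1.
transitivity (\prod_(i < p) ((\prod_(j < p) L i i ^+ (i <= j)%N) *
    \prod_(j < p) L j j ^+ (i <= j)%N)).
  by apply: eq_bigr => i _; rewrite -big_split.
rewrite big_split /= [X in _ * X]exchange_big -big_split -prodrXl /=.
apply: eq_bigr => i _; rewrite -big_split /=.
transitivity (\prod_(j < p) L i i ^+ ((i <= j)%N + (j <= i)%N)).
  by apply: eq_bigr => j _; rewrite exprD.
rewrite (bigD1 i)//= leqnn (eq_bigr (fun=> L i i)); last first.
  move=> j ji; rewrite -[RHS]expr1; congr (_ ^+ _).
  by move: ji; rewrite -val_eqE /=; lia.
rewrite prodr_const cardC1 card_ord -exprD; congr (_ ^+ _).
by have := ltn_ord i; lia.
Qed.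

Lemma sym_integral_congr_mx (F : 'M[R]_p -> \bar R) : (forall M, 0 <= F M)%E ->
  (sym_integral F <=
   ((\det L) ^+ p.+1)%:E * sym_integral (fun M => F (congr_mx M)))%E.
Proof.
move=> F0; rewrite /sym_integral -prod_diag_upper_idx.
exact: (@iint_congr_mx _ [::]).
Qed.

End congruence_substitution.

(** * Positive definite matrices *)

Section positive_definite.
Variable R : realType.

Definition qform (p : nat) (v : 'rV[R]_p) (M : 'M[R]_p) : R :=
  (v *m M *m v^T) 0 0.

Lemma qform0 p (M : 'M[R]_p) : qform 0 M = 0.
Proof. by rewrite /qform !mul0mx mxE. Qed.

Lemma posdef_congr p (L M : 'M[R]_p) : L \in unitmx ->
  posdef M -> posdef (L *m M *m L^T).
Proof.
move=> uL [symM M0]; split; first by rewrite !trmx_mul trmxK symM mulmxA.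
move=> v v0; have := M0 (v *m L); rewrite trmx_mul !mulmxA; apply.
by apply: contra_neq v0 => vL0; rewrite -[v](mulmxK uL) vL0 mul0mx.
Qed.

Lemma posdefZ p (M : 'M[R]_p) (a : R) : 0 < a -> posdef M -> posdef (a *: M).
Proof.
move=> a0 [symM M0]; split; first by rewrite linearZ /= symM.
move=> v v0; rewrite -scalemxAr -scalemxAl mxE mulr_gt0//; exact: M0.
Qed.

Lemma posdefD p (M N : 'M[R]_p) : posdef M -> posdef N -> posdef (M + N).
Proof.
move=> [symM M0] [symN N0]; split; first by rewrite linearD /= symM symN.
by move=> v v0; rewrite mulmxDr mulmxDl mxE addr_gt0 ?M0 ?N0.
Qed.

Lemma qform_block q (M : 'M[R]_(1 + q)) (x : R) (u : 'rV[R]_q) : M^T = M ->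
  qform (row_mx x%:M u) M =
  M 0 0 * x ^+ 2 + x * (u *m dlsubmx M) 0 0 *+ 2 + qform u (drsubmx M).
Proof.
move=> symM; rewrite /qform -[in LHS](submxK M) mul_row_block tr_row_mx mul_row_col.
have -> : ursubmx M = (dlsubmx M)^T by rewrite -[in LHS]symM -trmx_dlsub.
rewrite tr_scalar_mx mul_mx_scalar !mul_scalar_mx mulmxDl -scalemxAl -trmx_mul.
move: (u *m dlsubmx M) (u *m drsubmx M *m u^T) => sb m; rewrite !mxE.
have -> : M (lshift q 0) (lshift q 0) = M 0 0.
  by congr (M _ _); exact/val_inj.
ring.
Qed.

(** Induction on the size, splitting off the first row and column. The factors come as [C^T *m C]
    with [C] lower triangular, the order that later gives [L^T *m B *m L = B0] with a lower
    triangular [L]. The inverse [D] is built alongside, so that it is visibly triangular. *)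
Lemma cholesky p (M : 'M[R]_p) : posdef M ->
  exists C D : 'M[R]_p, [/\ is_trig_mx C, is_trig_mx D,
    (forall i, 0 < C i i /\ 0 < D i i), C^T *m C = M & C *m D = 1%:M].
Proof.
elim: p M => [|q IH] M [symM M0].
  exists 0, 0; split; try by apply/matrixP => -[].
  - by apply/is_trig_mxP => -[].
  - by apply/is_trig_mxP => -[].
  - by case.
suff step (N : 'M[R]_(1 + q)) : N^T = N ->
    (forall v : 'rV[R]_(1 + q), v != 0 -> 0 < qform v N) ->
    exists C D : 'M[R]_(1 + q), [/\ is_trig_mx C, is_trig_mx D,
      (forall i, 0 < C i i /\ 0 < D i i), C^T *m C = N & C *m D = 1%:M].
  exact: (step M).
move=> {M0}symN N0.
have M1pd : posdef (drsubmx N).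
  split; first by rewrite trmx_drsub symN.
  move=> v v0; have := N0 (row_mx 0%:M v).
  rewrite qform_block// expr0n mulr0 mul0r mul0rn !add0r.
  apply; apply: contra_neq v0 => /eqP; rewrite row_mx_eq0 => /andP[_ /eqP//].
have [C1 [D1 [trigC trigD diag C1E CD1]]] := IH _ M1pd.
have DC1 : D1 *m C1 = 1%:M by exact: mulmx1C.
pose b := dlsubmx N; pose c := D1^T *m b.
have cE : C1^T *m c = b by rewrite /c mulmxA -trmx_mul DC1 trmx1 mul1mx.
(* The Schur complement of the lower block. It is the value of the form at [(1, - w)], where [w] is
   [b^T] times the inverse of that block; hence it is positive. *)
pose e := N 0 0 - (c^T *m c) 0 0.
have e0 : 0 < e.
  pose w := c^T *m D1^T.
  have := N0 (row_mx 1%:M (- w)); rewrite qform_block//.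
  have -> : qform (- w) (drsubmx N) = (c^T *m c) 0 0.
    have wC : w *m C1^T = c^T by rewrite -mulmxA -trmx_mul CD1 trmx1 mulmx1.
    rewrite /qform -C1E mulNmx linearN /= mulmxN mulNmx opprK mulmxA wC.
    by rewrite -mulmxA -[C1 in LHS]trmxK -trmx_mul wC trmxK.
  have -> : - w *m dlsubmx N = - (c^T *m c) by rewrite mulNmx /w -mulmxA.
  rewrite expr1n mulr1 mul1r mxE => h.
  have : 0 < N 0 0 + - (c^T *m c) 0 0 *+ 2 + (c^T *m c) 0 0.
    by apply: h; rewrite row_mx_eq0 negb_and matrix_nonzero1.
  by rewrite /e; lra.
pose dl := Num.sqrt e; have dl0 : 0 < dl by rewrite sqrtr_gt0.
exists (block_mx dl%:M 0 c C1),
  (block_mx dl^-1%:M 0 (- (dl^-1 *: (D1 *m c))) D1); split.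
- by rewrite is_trig_block_mx// eqxx trigC andbT/= scalar_mx_is_trig.
- by rewrite is_trig_block_mx// eqxx trigD andbT/= scalar_mx_is_trig.
- move=> i; rewrite -[i]splitK; case: (fintype.split i) => j /=.
    by rewrite !block_mxEul !mxE eqxx !mulr1n invr_gt0.
  by rewrite !block_mxEdr; exact: diag.
- rewrite tr_block_mx mulmx_block trmx0 !mul0mx !mulmx0 !add0r cE C1E.
  rewrite -[RHS](@submxK _ 1 q 1 q N); congr block_mx => //.
  + apply/matrixP => i j; rewrite !ord1 tr_scalar_mx -scalar_mxM !mxE eqxx mulr1n.
    rewrite -expr2 sqr_sqrtr ?ltW// /e.
    have -> : N (lshift q 0) (lshift q 0) = N 0 0.
      by congr (N _ _); exact/val_inj.
    by rewrite !mxE subrK.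
  + rewrite -[c^T *m C1]trmxK trmx_mul trmxK cE /b.
    by rewrite trmx_dlsub symN.
- rewrite mulmx_block !mul0mx !mulmx0 !addr0 !add0r CD1 -scalar_mxM.
  rewrite mulfV ?gt_eqF// mulmxN -scalemxAr mulmxA CD1 mul1mx mul_mx_scalar.
  by rewrite subrr -scalar_mx_block.
Qed.

Lemma posdef_det_gt0 p (M : 'M[R]_p) : posdef M -> 0 < \det M.
Proof.
move=> /cholesky[C [D [trigC _ diag <- _]]].
rewrite det_mulmx det_tr det_trig// mulr_gt0//;
  by apply: prodr_gt0 => i _; have [] := diag i.
Qed.

Lemma posdef_unitmx p (M : 'M[R]_p) : posdef M -> M \in unitmx.
Proof. by move=> /posdef_det_gt0 M0; rewrite unitmxE unitfE gt_eqF. Qed.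

Lemma posdef_invmx p (M : 'M[R]_p) : posdef M -> posdef (invmx M).
Proof.
move=> pM; have uM := posdef_unitmx pM.
have symV : (invmx M)^T = invmx M by rewrite trmx_inv; case: pM => ->.
have := @posdef_congr _ (invmx M) M; rewrite unitmx_inv symV mulVmx// mul1mx.
exact.
Qed.

(** With [M = C^T *m C], cyclicity gives the trace of [C *m A *m C^T], whose diagonal entries are
    values of the form [A] at the rows of [C]. *)
Lemma trace_mulmx_ge0 p (A M : 'M[R]_p) : (forall v, 0 <= qform v A) ->
  posdef M -> 0 <= \tr (A *m M).
Proof.
move=> A0 /cholesky[C [D [_ _ _ <- _]]].
rewrite mulmxA mxtrace_mulC mulmxA; apply: sumr_ge0 => i _.
have -> : (C *m A *m C^T) i i = qform (row i C) A.
  by rewrite /qform -row_mul !mxE; apply: eq_bigr => j _; rewrite !mxE.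
exact: A0.
Qed.

(* With [u = v z^-1], expand [0 <= (u - v w^-1) w (u - v w^-1)^T] and bound
   [u w u^T] by [u z u^T = v z^-1 v^T]. *)
Lemma qform_invmxB_ge0 p (w z : 'M[R]_p) : posdef w -> posdef z ->
  posdef (z - w) -> forall v, 0 <= qform v (invmx w - invmx z).
Proof.
move=> pw pz [_ zw0] v.
have ge0 (M : 'M[R]_p) u : (forall v, v != 0 -> 0 < qform v M) -> 0 <= qform u M.
  move=> M0; have [->|/M0/ltW//] := eqVneq u 0.
  by rewrite qform0.
have uw := posdef_unitmx pw; have uz := posdef_unitmx pz.
have [symVw _] := posdef_invmx pw; have [symVz _] := posdef_invmx pz.
pose u := v *m invmx z.
have h1 := ge0 _ u zw0; have h2 := ge0 _ (u - v *m invmx w) pw.2.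
have qB (x : 'rV[R]_p) A B : qform x (A - B) = qform x A - qform x B.
  by rewrite /qform mulmxBr mulmxBl !mxE.
have uz_z : qform u z = qform v (invmx z).
  by rewrite /qform /u trmx_mul symVz mulmxA mulmxKV.
have : qform (u - v *m invmx w) w =
    qform u w - qform v (invmx z) *+ 2 + qform v (invmx w).
  rewrite /qform mulmxBl mulmxKV// linearB /= [(v *m invmx w)^T]trmx_mul symVw.
  rewrite mulmxBr !mulmxBl mulmxA mulmxK//.
  have -> : u *m v^T = v *m invmx z *m v^T by [].
  have -> : v *m u^T = v *m invmx z *m v^T by rewrite /u trmx_mul symVz mulmxA.
  rewrite mulmxA !mxE; ring.
by move: h1 h2; rewrite !qB uz_z; lra.
Qed.

(** Completing the square, multiplied through by [M 0 0] so that the Schur complement stays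
    polynomial in the entries, which suits [measurable_posdef]. *)
Lemma posdef_schur q (M : 'M[R]_(1 + q)) : posdef M <->
  [/\ M^T = M, 0 < M 0 0 &
      posdef (M 0 0 *: drsubmx M - dlsubmx M *m (dlsubmx M)^T)].
Proof.
pose b := dlsubmx M; pose a := M 0 0.
have qS u : qform u (a *: drsubmx M - b *m b^T) =
    a * qform u (drsubmx M) - (u *m b) 0 0 ^+ 2.
  rewrite /qform mulmxBr mulmxBl -scalemxAr -scalemxAl mulmxA -mulmxA -trmx_mul.
  by rewrite !mxE big_ord1 !mxE expr2.
have qE x u : M^T = M -> a * qform (row_mx x%:M u) M =
    (a * x + (u *m b) 0 0) ^+ 2 + qform u (a *: drsubmx M - b *m b^T).
  by move=> symM; rewrite qform_block// qS -/a -/b; ring.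
split.
  move=> [symM M0].
  have a0 : 0 < a.
    have := M0 (row_mx 1%:M 0); rewrite -/(qform _ M) qform_block//.
    rewrite mul0mx mxE mulr0 mul0rn expr1n mulr1 addr0 qform0 addr0.
    by apply; rewrite row_mx_eq0 negb_and matrix_nonzero1.
  split => //; split.
    rewrite linearB /= linearZ /= trmx_mul trmxK trmx_drsub symM//.
  move=> u u0; rewrite -/(qform _ _).
  have := M0 (row_mx (- ((u *m b) 0 0 / a))%:M u).
  rewrite -/(qform _ M) -(pmulr_rgt0 _ a0) qE//.
  rewrite mulrN mulrCA divff ?gt_eqF// mulr1 addNr expr0n add0r; apply.
  by rewrite row_mx_eq0 negb_and u0 orbT.
move=> [symM a0 [_ S0]]; split=> // v v0; rewrite -/(qform v M).
rewrite -(pmulr_rgt0 _ a0) -[v]hsubmxK [lsubmx v]mx11_scalar qE//.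
have [u0|/S0 pos] := eqVneq (rsubmx v) 0; last by rewrite ltr_wpDl// sqr_ge0.
rewrite u0 qform0 addr0.
have -> : ((0 : 'rV[R]_q) *m b) 0 0 = 0 by rewrite mul0mx mxE.
rewrite addr0 exprn_even_gt0//= mulf_neq0//; first by rewrite gt_eqF.
apply: contraNneq v0 => l0; rewrite -[v]hsubmxK u0 [lsubmx v]mx11_scalar l0.
by rewrite raddf0 row_mx0.
Qed.

(** Positivity at every [v] is an uncountable condition; the Schur recursion replaces it by finitely
    many equalities and strict inequalities between measurable functions. *)
Lemma measurable_posdef d (T : measurableType d) p (M : T -> 'M[R]_p) :
  (forall i j, measurable_fun setT (fun t => M t i j)) ->
  measurable [set t | posdef (M t)].
Proof.
elim: p M => [|q IH] M mM.
  rewrite (_ : [set _ | _] = setT)//; apply/seteqP; split => // t _; split.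
    by apply/matrixP => -[].
  by move=> v; rewrite thinmx0 eqxx.
pose N t : 'M[R]_(1 + q) := M t.
rewrite (_ : [set _ | _] = [set t | (M t)^T = M t] `&` [set t | 0 < M t 0 0] `&`
    [set t | posdef (N t 0 0 *: drsubmx (N t) -
                     dlsubmx (N t) *m (dlsubmx (N t))^T)]); last first.
  by apply/seteqP; split => t /=; rewrite (@posdef_schur _ (N t));
    [case=> ? ? ?; split|move=> [[? ?] ?]; split].
apply: measurableI; [apply: measurableI|].
- rewrite (_ : [set _ | _] = \big[setI/setT]_(i < q.+1) \big[setI/setT]_(j < q.+1)
      [set t | M t j i = M t i j]).
    apply: bigsetI_measurable => i _; apply: bigsetI_measurable => j _.
    rewrite (_ : [set _ | _] = (fun t => M t j i == M t i j) @^-1` [set true]).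
      rewrite -[X in measurable X]setTI.
      by apply: measurable_fun_eqr.
    by apply/seteqP; split => t /= /eqP.
  apply/seteqP; split => t /=.
    move=> symM; rewrite -bigcap_seq => i _ /=; rewrite -bigcap_seq => j _ /=.
    by rewrite -[in RHS]symM mxE.
  rewrite -bigcap_seq => h; apply/matrixP => i j; rewrite mxE.
  have /= := h i; rewrite -bigcap_seq => /(_ _ j); apply; exact: mem_index_enum.
- rewrite (_ : [set _ | _] = (fun t => 0 < M t 0 0) @^-1` [set true]) //.
  by rewrite -[X in measurable X]setTI; apply: measurable_fun_ltr.
- apply: IH => i j; under eq_fun do rewrite !mxE big_ord1 !mxE.
  by apply: measurable_funB; apply: measurable_funM.
Qed.

End positive_definite.

(** * Expectations, densities and independence *)

Section simple_functions_as_sums.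
Context d (T : measurableType d) (R : realType).

Import HBNNSimple.

Lemma nnsfun_sum_indic (h : {nnsfun T >-> R}) :
  exists (N : nat) (c : 'I_N -> R) (A : 'I_N -> set T),
    [/\ (forall i, 0 <= c i), (forall i, measurable (A i)) &
        forall x, h x = \sum_(i < N) c i * \1_(A i) x].
Proof.
exists #|` fset_set (range h)|, (fun i => (fset_set (range h))`_i),
  (fun i => h @^-1` [set (fset_set (range h))`_i]); split => //.
- move=> i.
  have : (fset_set (range h))`_i \in fset_set (range h) by exact: mem_nth.
  by rewrite in_fset_set// => /set_mem[x _ <-].
- exact: fimfunEord.
Qed.

Lemma integral_sum_indic (mu : {measure set T -> \bar R}) (I : finType)
    (c : I -> R) (A : I -> set T) :
  (forall i, 0 <= c i) -> (forall i, measurable (A i)) ->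
  (\int[mu]_x (\sum_i c i * \1_(A i) x)%:E = \sum_i (c i)%:E * mu (A i))%E.
Proof.
move=> c0 mA; under eq_integral do rewrite -sumEFin.
rewrite ge0_integral_sum//; last 2 first.
- move=> i; apply/measurable_EFinP; apply: measurable_funM.
    exact: measurable_cst.
  exact: measurable_indic.
- by move=> i x _; rewrite lee_fin mulr_ge0.
apply: eq_bigr => i _; under eq_integral do rewrite EFinM.
rewrite ge0_integralZl_EFin//.
- by rewrite integral_indic// setIT.
- exact/measurable_EFinP/measurable_indic.
Qed.

End simple_functions_as_sums.

Section matrix_sigma_algebra.
Context (R : realType) (p : nat).

Let G : set (set 'M[R]_p) :=
  \big[setU/set0]_k preimage_set_system setT (@mx_coord R p k) measurable.

Lemma mx_measurable_entry (i j : 'I_p) (B : set R) : measurable B ->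
  mx_measurable [set M : 'M[R]_p | B (M i j)].
Proof.
move=> mB; apply: sub_sigma_algebra; rewrite -bigcup_seq.
exists (enum_rank (i, j)); first by rewrite /= mem_index_enum.
by exists B => //; rewrite setTI /mx_coord; apply/seteqP; split => M /=;
  rewrite enum_rankK.
Qed.

Lemma mx_measurable_preimage_expR_tr (S : 'M[R]_p) (B : set R) : measurable B ->
  mx_measurable ((fun M => expR (\tr (S *m M))) @^-1` B).
Proof.
have mentry i j : measurable_fun setT
    (fun M : g_sigma_algebraType G => (M : 'M[R]_p) i j).
  by move=> _ C mC; rewrite setTI; exact: mx_measurable_entry.
have mg : measurable_fun setT
    (fun M : g_sigma_algebraType G => expR (\tr (S *m (M : 'M[R]_p)))).
  apply: measurableT_comp => //; apply: measurable_sum => i.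
  under eq_fun do rewrite mxE.
  by apply: measurable_sum => j; apply: measurable_funM.
by move=> mB; have := mg measurableT B mB; rewrite setTI.
Qed.

End matrix_sigma_algebra.

Section density.
Local Open Scope ereal_scope.
Context (R : realType) (p : nat) d (T : measurableType d).
Variables (P : probability T R) (X : T -> 'M[R]_p) (f g : 'M[R]_p -> R).
Hypotheses (f0 : forall M, (0 <= f M)%R) (g0 : forall M, (0 <= g M)%R).
Hypothesis mg : forall B, measurable B -> mx_measurable (g @^-1` B).
Hypothesis pdfX : has_mx_pdf P X f.

Lemma measurable_fun_mx_comp : measurable_fun setT (g \o X).
Proof.
by move=> _ B mB; rewrite setTI comp_preimage; apply: pdfX.1; exact: mg.
Qed.

Import HBNNSimple.

(** The law of [g \o X] lives on the line, where a simple function is a finite combination of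
    indicators. [has_mx_pdf] evaluates each indicator, and superadditivity of the iterated integral
    collects the terms. *)
Lemma expectation_le_sym_integral :
  \int[P]_t (g (X t))%:E <= sym_integral (fun M => (g M * f M)%:E).
Proof.
have mY := measurable_fun_mx_comp.
pose mixin := isMeasurableFun.Build _ _ _ _ _ mY.
pose Y : {mfun T >-> R} := HB.pack (g \o X) mixin.
(* The absolute value makes the integrand nonnegative on the whole line and changes nothing at the
   values of [g]. *)
have -> : \int[P]_t (g (X t))%:E = \int[pushforward P Y]_y `|y|%:E.
  rewrite ge0_integral_pushforward//.
  - by rewrite preimage_setT; apply: eq_integral => t _; rewrite /= ger0_norm.
  - exact/measurable_EFinP.
apply: integral_le_sintegral => // h hle.
have [N [c [A [c0 mA hE]]]] := nnsfun_sum_indic h.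
rewrite -integralT_nnsfun; under eq_integral do rewrite hE.
rewrite (integral_sum_indic _ c0 mA).
apply: (@le_trans _ _ (\sum_(i < N)
    sym_integral (fun M => (c i * \1_(g @^-1` A i) M * f M)%:E))).
  apply: lee_sum => i _.
  rewrite [X in _ * X <= _](_ : _ =
      sym_integral (fun M => (\1_(g @^-1` A i) M * f M)%:E)); last first.
    by apply: pdfX.2; exact: mg.
  apply: le_trans (ge0_iintZl _ _ _ (c0 i)) _ => [k|].
    by rewrite lee_fin mulr_ge0.
  apply: ge0_le_iint => k.
    by rewrite mule_ge0 ?lee_fin// mulr_ge0.
  by rewrite -EFinM mulrA.
apply: le_trans (ge0_iint_sum _ _ _ _) _ => [i k|].
  by rewrite lee_fin !mulr_ge0.
apply: ge0_le_iint => k.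
  by apply: sume_ge0 => i _; rewrite lee_fin !mulr_ge0.
rewrite sumEFin lee_fin -mulr_suml ler_wpM2r//.
by have := hle (g (symmx k)); rewrite hE lee_fin ger0_norm.
Qed.

End density.

Section independence.
Local Open Scope ereal_scope.
Context (R : realType) d (T : measurableType d) (P : probability T R) (n : nat).
Variable Y : 'I_n -> T -> R.
Hypothesis Y0 : forall l t, (0 <= Y l t)%R.
Hypothesis mY : forall l, measurable_fun setT (Y l).
Hypothesis indepY : forall B : 'I_n -> set R, (forall l, measurable (B l)) ->
  P (\bigcap_(l in [set: 'I_n]) (Y l @^-1` B l)) = \prod_(l < n) P (Y l @^-1` B l).

Let mpreim l B : measurable B -> measurable (Y l @^-1` B).
Proof. by move=> mB; rewrite -[X in measurable X]setTI; exact: mY. Qed.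

(** The product expands into a sum over the choices [r] of one index per factor. Each term is a
    multiple of the indicator of an intersection, where independence applies; the same expansion
    read backwards factors the result. *)
Let expectation_prod_sum_indic N (c : 'I_N -> R) (A : 'I_N -> set R) :
  (forall i, 0 <= c i)%R -> (forall i, measurable (A i)) ->
  \int[P]_t (\prod_l \sum_i c i * \1_(A i) (Y l t))%:E =
  \prod_l \int[P]_t (\sum_i c i * \1_(A i) (Y l t))%:E.
Proof.
move=> c0 mA.
pose B (r : {ffun 'I_n -> 'I_N}) := \bigcap_(l in setT) (Y l @^-1` A (r l)).
have prodE t : (\prod_l \sum_i c i * \1_(A i) (Y l t) =
    \sum_(r : {ffun 'I_n -> 'I_N}) (\prod_l c (r l)) * \1_(B r) t)%R.
  rewrite bigA_distr_bigA /=; apply: eq_bigr => r _; rewrite big_split /=.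
  congr (_ * _)%R; have [tB|tB] := pselect (B r t).
    rewrite indicE mem_set// big1// => l _.
    by rewrite indicE mem_set//; exact: tB.
  rewrite indicE memNset//=; move/existsNP : tB => [l /not_implyP[_ tl]].
  by apply/eqP/prodf_eq0; exists l => //; rewrite indicE memNset.
under eq_integral do rewrite prodE.
rewrite integral_sum_indic; last 2 first.
- by move=> r; exact: prodr_ge0.
- move=> r; apply: fin_bigcap_measurable; first exact: finite_finset.
  by move=> l _; exact: mpreim.
transitivity (\sum_(r : {ffun 'I_n -> 'I_N})
   (\prod_l (c (r l) * fine (P (Y l @^-1` A (r l)))))%:E).
  apply: eq_bigr => r _; rewrite big_split EFinM; congr (_ * _).
  rewrite -prodEFin; apply: etrans (indepY (fun l => mA (r l))) _.
  apply: eq_bigr => l _.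
  by rewrite fineK// fin_num_measure//; exact: mpreim.
rewrite sumEFin -(bigA_distr_bigA (fun l i => c i * fine (P (Y l @^-1` A i)))%R).
rewrite -prodEFin; apply: eq_bigr => l _; rewrite -sumEFin.
rewrite (integral_sum_indic P c0 (fun i => mpreim l (mA i))).
apply: eq_bigr => i _; rewrite EFinM fineK// fin_num_measure//; exact: mpreim.
Qed.

Import HBNNSimple.

(** For simple functions of the [Y l] the expectation of the product factors exactly; monotone
    convergence passes to the limit. *)
Lemma expectation_prod_le (K : R) :
  (forall l, \int[P]_t (Y l t)%:E <= K%:E) ->
  \int[P]_t (\prod_l Y l t)%:E <= (K ^+ n)%:E.
Proof.
move=> YK.
have mnorm : measurable_fun [set: R] (fun y : R => `|y|%:E).
  exact/measurable_EFinP.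
(* The approximation is made on the line and not on [T], so that each [h m (Y l t)] is a function of
   [Y l t] and independence carries over. *)
pose h := nnsfun_approx measurableT mnorm.
have norm0 (y : R) : [set: R] y -> 0 <= (fun y : R => `|y|%:E) y by [].
have cvg_h (y : R) : (h m y @[m --> \oo] --> `|y|)%R.
  exact: fine_cvg (cvg_nnsfun_approx measurableT mnorm norm0 (I : setT y)).
have nd_h (y : R) : nondecreasing_seq (fun m => h m y).
  by move=> m k mk; exact/lefP/nd_nnsfun_approx.
have h_le m (y : R) : (h m y <= `|y|)%R.
  rewrite -(cvg_lim _ (cvg_h y))//; apply: nondecreasing_cvgn_le (nd_h y) _ m.
  by apply/cvg_ex; exists `|y|%R; exact: cvg_h.
have bound m : \int[P]_t (\prod_l h m (Y l t))%:E <= (K ^+ n)%:E.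
  have [N [c [A [c0 mA hE]]]] := nnsfun_sum_indic (h m).
  have -> : \int[P]_t (\prod_l h m (Y l t))%:E =
      \int[P]_t (\prod_l \sum_i c i * \1_(A i) (Y l t))%:E.
    by apply: eq_integral => t _; congr EFin; apply: eq_bigr.
  rewrite expectation_prod_sum_indic//.
  pose e l := \int[P]_t (h m (Y l t))%:E.
  have e0 l : 0 <= e l by apply: integral_ge0 => t _; rewrite lee_fin.
  have eK l : e l <= K%:E.
    apply: le_trans (YK l); apply: ge0_le_lower_integral => t.
      by rewrite lee_fin.
    by rewrite lee_fin (le_trans (h_le _ _))// ger0_norm.
  have e_fin l : e l = (fine (e l))%:E.
    by rewrite fineK// ge0_fin_numE// (le_lt_trans (eK l))// ltry.
  rewrite (eq_bigr (fun l => (fine (e l))%:E)); last first.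
    by move=> l _; rewrite -e_fin; apply: eq_integral => t _; rewrite hE.
  rewrite prodEFin lee_fin -[X in (_ ^+ X)%R]card_ord -prodr_const.
  apply: ler_prod => l _; rewrite fine_ge0//=.
  by rewrite -lee_fin -e_fin.
have prod_cvg t : (\prod_l h m (Y l t))%:E @[m --> \oo] --> (\prod_l Y l t)%:E.
  apply: cvg_EFin; first exact: nearW.
  apply: (@cvg_big R 'I_n *%R 1%R xpredT (@mul_continuous R) nat \oo
    (index_enum 'I_n) (fun l m => h m (Y l t)) (fun l => Y l t)).
  by move=> l _; have := cvg_h (Y l t); rewrite ger0_norm.
have -> : \int[P]_t (\prod_l Y l t)%:E =
    \int[P]_t limn (fun m => (\prod_l h m (Y l t))%:E).
  by apply: eq_integral => t _; apply/esym/cvg_lim => //; exact: prod_cvg.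
have mprod m : measurable_fun setT (fun t => (\prod_l h m (Y l t))%:E).
  apply/measurable_EFinP; apply: measurable_prod => l _.
  exact: measurableT_comp.
have prod0 m t : [set: T] t -> 0 <= (\prod_l h m (Y l t))%:E.
  by move=> _; rewrite lee_fin; exact: prodr_ge0.
have nd_prod t : [set: T] t ->
    nondecreasing_seq (fun m => (\prod_l h m (Y l t))%:E).
  move=> _ m k mk; rewrite lee_fin; apply: ler_prod => l _.
  by rewrite fun_ge0 nd_h.
rewrite monotone_convergence//; apply: lime_le; last exact: nearW.
apply: ereal_nondecreasing_is_cvgn => m k mk.
apply: ge0_le_integral => // t _; first exact: prod0.
exact: nd_prod.
Qed.

End independence.

(** * The matrix gamma density *)

Lemma powR_expR_ln (R : realType) (x y : R) : 0 < x -> x `^ y = expR (y * ln x).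
Proof. by move=> x0; rewrite /powR gt_eqF. Qed.

Section lower_triangular_congruence.
Context (R : realType) (p : nat).

Lemma posdef_congr_trig (B B0 : 'M[R]_p) : posdef B -> posdef B0 ->
  exists L : 'M[R]_p, [/\ is_trig_mx L, (forall i, 0 < L i i) & L^T *m B *m L = B0].
Proof.
move=> /cholesky[C [D [_ trigD diagD <- CD]]].
move=> /cholesky[C0 [D0 [trigC0 _ diagC0 <- _]]].
have tD (i j : 'I_p) : (i < j)%N -> D i j = 0 by move/is_trig_mxP: trigD; apply.
have tC0 (i j : 'I_p) : (i < j)%N -> C0 i j = 0 by move/is_trig_mxP: trigC0; apply.
exists (D *m C0); split.
- apply/is_trig_mxP => i j ij; rewrite mxE big1// => k _.
  have [ik|ki] := ltnP i k; first by rewrite tD// mul0r.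
  by rewrite tC0 ?mulr0// (leq_ltn_trans ki).
- move=> i; rewrite mxE (bigD1 i)//= big1 ?addr0.
    by rewrite mulr_gt0//; [have [] := diagD i|have [] := diagC0 i].
  move=> k ki; case: (ltngtP k i) => [lt|lt|/val_inj eq].
  + by rewrite tC0// mulr0.
  + by rewrite tD// mul0r.
  + by rewrite eq eqxx in ki.
- rewrite trmx_mul -!mulmxA; congr (_ *m _).
  by rewrite [C *m _]mulmxA CD mul1mx mulmxA -trmx_mul CD trmx1 mul1mx.
Qed.

End lower_triangular_congruence.

Section matrix_gamma.
Context (R : realType) (p : nat) (alpha beta : R) (Sigma : 'M[R]_p).
Hypotheses (beta0 : 0 < beta) (pSigma : posdef Sigma).
Local Notation f := (mgamma_pdf alpha beta Sigma).
Let B0 := beta^-1 *: invmx Sigma.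

Let pB0 : posdef B0.
Proof. by apply: posdefZ; [rewrite invr_gt0|exact: posdef_invmx]. Qed.

Lemma mgamma_pdf_ge0 x : 0 <= f x.
Proof.
rewrite /mgamma_pdf mulr_ge0// !mulr_ge0 ?powR_ge0 ?expR_ge0// invr_ge0.
rewrite !mulr_ge0 ?powR_ge0//; apply: prodr_ge0 => j _; apply: fine_ge0.
by apply: integral_ge0 => x' _; rewrite lee_fin mulr_ge0 ?powR_ge0 ?expR_ge0.
Qed.

(** The tilt replaces [B0] by [B] in the exponent, and cyclicity with [L^T *m B *m L = B0] restores
    the exponent of [f M]. Congruence preserves positive definiteness, so the indicators agree; the
    determinant supplies the power of [\det L]. *)
Lemma mgamma_pdf_congr_mx (B L M : 'M[R]_p) : L \in unitmx ->
  L^T *m B *m L = B0 ->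
  expR (\tr ((B0 - B) *m congr_mx L M)) * f (congr_mx L M) =
  ((\det L) ^+ 2) `^ (alpha - (p.+1)%:R / 2) * f M.
Proof.
move=> uL LB; rewrite /mgamma_pdf.
have [pM|npM] := pselect (posdef M); last first.
  rewrite !indicE [in RHS]memNset// memNset ?mul0r ?mulr0//= => pLM; apply: npM.
  have uV : invmx L \in unitmx by rewrite unitmx_inv.
  have := posdef_congr uV pLM; rewrite /congr_mx !mulmxA mulVmx// mul1mx.
  by rewrite -mulmxA -trmx_mul mulVmx// trmx1 mulmx1.
have pLM : posdef (congr_mx L M) by exact: posdef_congr.
rewrite !indicE !mem_set//= !mul1r /congr_mx !det_mulmx det_tr.
have -> : \det L * \det M * \det L = (\det L) ^+ 2 * \det M by ring.
rewrite powRM ?sqr_ge0//; last by rewrite ltW// posdef_det_gt0.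
set K := powR (\det Sigma) _ / _.
set a := powR (_ ^+ 2) _; set b := powR (\det M) _.
have -> : beta^-1 * \tr (invmx Sigma *m (L *m M *m L^T)) =
    \tr (B0 *m (L *m M *m L^T)) by rewrite -scalemxAl mxtraceZ.
have -> : beta^-1 * \tr (invmx Sigma *m M) = \tr (B *m (L *m M *m L^T)).
  by rewrite -mxtraceZ scalemxAl -/B0 -LB !mulmxA [RHS]mxtrace_mulC !mulmxA.
rewrite mulmxBl raddfB /=.
set u := \tr _; set v := \tr _.
transitivity (a * (K * b * (expR (u - v) * expR (- u)))); first by ring.
by rewrite -expRD addrAC subrr add0r.
Qed.

(** The Jacobian [(\det L) ^+ p.+1] cancels the [- p.+1] in the exponent [2 * alpha - p.+1] of
    [\det L], and [(\det L) ^+ 2] is [\det B0 / \det B]. *)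
Lemma sym_integral_mgamma_pdf_tilt (B : 'M[R]_p) : posdef B ->
  (sym_integral (fun M => (f M)%:E) <= 1)%E ->
  (sym_integral (fun M => (expR (\tr ((B0 - B) *m M)) * f M)%:E) <=
   ((\det B0 / \det B) `^ alpha)%:E)%E.
Proof.
move=> pB f1; have [L [trigL diagL LB]] := posdef_congr_trig pB pB0.
have x0 : 0 < \det L by rewrite det_trig//; exact: prodr_gt0.
have uL : L \in unitmx by rewrite unitmxE unitfE gt_eqF.
pose k := ((\det L) ^+ 2) `^ (alpha - (p.+1)%:R / 2).
have k0 : 0 < k by rewrite powR_gt0// exprn_gt0.
apply: le_trans (sym_integral_congr_mx trigL diagL _) _.
  by move=> M; rewrite lee_fin mulr_ge0 ?expR_ge0// mgamma_pdf_ge0.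
have kf : (sym_integral (fun M => (k * f M)%:E) <= k%:E)%E.
  rewrite -[leRHS]mule1 -lee_pdivrMl//; apply: le_trans f1.
  apply: le_trans (ge0_iintZl _ _ _ _) _.
  - by move=> c; rewrite lee_fin mulr_ge0 ?(ltW k0)// mgamma_pdf_ge0.
  - by rewrite invr_ge0 ltW.
  - apply: ge0_le_iint => c.
      rewrite -EFinM lee_fin mulr_ge0 ?invr_ge0 ?(ltW k0)//.
      by rewrite mulr_ge0 ?(ltW k0)// mgamma_pdf_ge0.
    by rewrite -EFinM mulrA mulVf ?gt_eqF// mul1r.
rewrite (_ : (fun M => _) = (fun M => (k * f M)%:E)); last first.
  by apply/funext => M; rewrite (mgamma_pdf_congr_mx _ uL LB).
apply: le_trans (_ : (_ <= (\det L ^+ p.+1)%:E * k%:E)%E) _.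
  by rewrite lee_wpmul2l// lee_fin exprn_ge0// ltW.
have -> : \det B0 / \det B = \det L ^+ 2.
  rewrite -LB !det_mulmx det_tr.
  by field; rewrite gt_eqF// posdef_det_gt0.
rewrite -EFinM lee_fin /k !powR_expR_ln ?exprn_gt0// lnXn//.
rewrite -[X in X ^+ _]lnK ?posrE// -expRM_natl -expRD ler_expR.
rewrite le_eqVlt; apply/orP; left; apply/eqP.
by rewrite mulrBl -[in X in _ - X]mulr_natl; field.
Qed.

End matrix_gamma.

(** * The Chernoff bound *)

Section chernoff.
Context (R : realType) (d : measure_display) (T : measurableType d).
Variables (P : probability T R) (p n : nat) (alpha beta : R) (Sigma : 'M[R]_p).
Variable X : 'I_n -> T -> 'M[R]_p.
Hypotheses (alpha0 : 0 < alpha) (beta0 : 0 < beta) (n0 : (0 < n)%N).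
Hypothesis pSigma : posdef Sigma.
Hypothesis indepX : mx_indep P X.
Hypothesis pdfX : forall l, has_mx_pdf P (X l) (mgamma_pdf alpha beta Sigma).

Definition chernoff_base (z : 'M[R]_p) : R :=
  powR (expR 1 / (alpha * beta)) (p%:R * alpha) *
  powR (\det z / \det Sigma) alpha *
  expR (- (beta^-1 * \tr (invmx Sigma *m z))).

(* The minimiser of [S |-> E exp(tr (S X)) exp(- tr (S z))]. *)
Definition tilt (z : 'M[R]_p) : 'M[R]_p :=
  beta^-1 *: invmx Sigma - alpha *: invmx z.

(** The total mass is read off the density hypothesis for one observation at the whole space; this
    is where [n0] enters. *)
Lemma sym_integral_mgamma_pdf_le1 :
  (sym_integral (fun M => (mgamma_pdf alpha beta Sigma M)%:E) <= 1)%E.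
Proof.
have mT : mx_measurable [set: 'M[R]_p].
  by rewrite -setC0; apply: sigma_algebraC; exact: sigma_algebra0.
have := (pdfX (Ordinal n0)).2 _ mT; rewrite preimage_setT probability_setT => ->.
by apply: ge0_le_iint => c; rewrite ?indicT ?mul1r// lee_fin mgamma_pdf_ge0.
Qed.

Lemma expectation_expR_tilt_le z l : posdef z ->
  (\int[P]_t (expR (\tr (tilt z *m X l t)))%:E <=
   ((\det (beta^-1 *: invmx Sigma) / \det (alpha *: invmx z)) `^ alpha)%:E)%E.
Proof.
move=> pz; apply: le_trans (sym_integral_mgamma_pdf_tilt beta0 pSigma _
  sym_integral_mgamma_pdf_le1); last exact/posdefZ/posdef_invmx.
apply: (expectation_le_sym_integral _ _ _ (pdfX l)).
- by move=> M; exact: mgamma_pdf_ge0.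
- by move=> M; exact: expR_ge0.
- by move=> B; exact: mx_measurable_preimage_expR_tr.
Qed.

(** The term [alpha *: invmx z] of the tilt contributes [alpha * p] to the trace, which produces the
    power of [expR 1]. *)
Lemma chernoff_baseE z : posdef z ->
  (\det (beta^-1 *: invmx Sigma) / \det (alpha *: invmx z)) `^ alpha *
  expR (- \tr (tilt z *m z)) = chernoff_base z.
Proof.
move=> pz; have z0 := posdef_det_gt0 pz; have S0 := posdef_det_gt0 pSigma.
rewrite /chernoff_base /tilt !detZ !det_inv mulmxBl -!scalemxAl.
rewrite mulVmx ?posdef_unitmx//.
rewrite raddfB /= !mxtraceZ mxtrace1; set tau := \tr _.
have -> : beta^-1 ^+ p / \det Sigma / (alpha ^+ p / \det z) =
    (\det z / \det Sigma) * ((alpha * beta)^-1) ^+ p.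
  rewrite [(alpha * beta)^-1]invfM exprMn !exprVn; field.
  by rewrite !gt_eqF ?exprn_gt0.
have ab0 : 0 < alpha * beta by rewrite mulr_gt0.
have abp : 0 <= (alpha * beta)^-1 ^+ p by rewrite exprn_ge0// invr_ge0 ltW.
rewrite (powRM _ (divr_ge0 (ltW z0) (ltW S0)) abp).
rewrite powRrM powR_mulrn ?divr_ge0 ?expR_ge0 ?(ltW ab0)//.
rewrite exprMn (powRM _ _ abp) ?exprn_ge0 ?expR_ge0// -expRM_natl mulr1 -expRM.
by rewrite opprB expRD [alpha * p%:R]mulrC; ring.
Qed.

Lemma probability_le_chernoff_base z (E : set T) : posdef z -> measurable E ->
  (forall t, E t -> 0 <= \tr (tilt z *m (mx_mean X t - z))) ->
  (P E <= (chernoff_base z ^+ n)%:E)%E.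
Proof.
move=> pz mE Ez.
pose Y l t := expR (\tr (tilt z *m X l t)).
pose K := (\det (beta^-1 *: invmx Sigma) / \det (alpha *: invmx z)) `^ alpha.
have mY l : measurable_fun setT (Y l).
  apply: (@measurable_fun_mx_comp _ _ _ _ _ _ _
    (fun M => expR (\tr (tilt z *m M))) _ (pdfX l)) => B.
  exact: mx_measurable_preimage_expR_tr.
have Y0 l t : 0 <= Y l t by exact: expR_ge0.
have prodYK : (\int[P]_t (\prod_l Y l t)%:E <= (K ^+ n)%:E)%E.
  apply: expectation_prod_le => //.
  - move=> B mB; have := @indepX (fun l =>
      (fun M => expR (\tr (tilt z *m M))) @^-1` B l).
    apply => l; exact: mx_measurable_preimage_expR_tr.
  - by move=> l; exact: expectation_expR_tilt_le.
(* The level in Markov's inequality: on [E] the product of the [Y l] is the exponential of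
   [n%:R * \tr (tilt z *m mx_mean X t)], which is at least [w]. *)
pose w := expR (\tr (tilt z *m z)) ^+ n.
have w0 : 0 < w by rewrite exprn_gt0// expR_gt0.
have wE : (w%:E * P E <= (K ^+ n)%:E)%E.
  apply: le_trans prodYK.
  rewrite -[E]setIT -integral_indic// -ge0_integralZl_EFin ?(ltW w0)//; last first.
    exact/measurable_EFinP/measurable_indic.
  apply: ge0_le_lower_integral => t.
    by rewrite -EFinM lee_fin mulr_ge0// ltW.
  rewrite -EFinM lee_fin indicE.
  have [tE|tE] := pselect (E t); last first.
    by rewrite memNset// mulr0 prodr_ge0.
  rewrite mem_set// mulr1 /w /Y -expRM_natl -expR_sum ler_expR.
  have -> : \sum_l \tr (tilt z *m X l t) = n%:R * \tr (tilt z *m mx_mean X t).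
    rewrite -raddf_sum -mulmx_sumr /mx_mean -scalemxAr mxtraceZ mulrA mulfV ?mul1r//.
    by rewrite pnatr_eq0 -lt0n.
  rewrite ler_wpM2l//.
  by have := Ez t tE; rewrite mulmxBr raddfB /= subr_ge0.
rewrite -chernoff_baseE// -/K exprMn expRN exprVn -/w mulrC EFinM.
by rewrite lee_pdivlMl.
Qed.

Lemma measurable_mx_mean i j : measurable_fun setT (fun t => mx_mean X t i j).
Proof.
have mX l : measurable_fun setT (fun t => X l t i j).
  by move=> _ B mB; rewrite setTI; exact: (pdfX l).1 _ (mx_measurable_entry i j mB).
rewrite /mx_mean; under eq_fun do rewrite mxE summxE.
by apply: measurable_funM => //; exact: measurable_sum.
Qed.

End chernoff.

(** The determinant ratio is [(rho * (alpha * beta)) ^+ p] and the exponential has exponent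
    [- (rho * alpha * p%:R)], so the powers of [alpha * beta] cancel. Both sides are compared as
    exponentials. *)
Lemma chernoff_base_scaled_mean (R : realType) (p n : nat) (alpha beta rho : R)
    (Sigma : 'M[R]_p) : 0 < alpha -> 0 < beta -> 0 < rho -> posdef Sigma ->
  chernoff_base alpha beta Sigma (rho *: ((alpha * beta) *: Sigma)) ^+ n =
  (rho * expR (1 - rho)) `^ (n%:R * p%:R * alpha).
Proof.
move=> alpha0 beta0 rho0 pSigma; have S0 := posdef_det_gt0 pSigma.
have ab0 : 0 < alpha * beta by rewrite mulr_gt0.
rewrite /chernoff_base !scalerA detZ -scalemxAr mulVmx ?posdef_unitmx//.
rewrite mxtraceZ mxtrace1 mulfK ?gt_eqF//.
rewrite !powR_expR_ln ?mulr_gt0 ?exprn_gt0 ?invr_gt0 ?expR_gt0 ?mulr_gt0//.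
rewrite -!expRD -expRM_natl; congr expR.
rewrite lnXn ?mulr_gt0// !lnM ?posrE ?invr_gt0 ?expR_gt0//; try by rewrite mulr_gt0.
rewrite lnV ?posrE// lnM ?posrE// !expRK.
by field; rewrite gt_eqF.
Qed.

Theorem theorem13 (R : realType) (d : measure_display) (T : measurableType d)
  (P : probability T R) (p n : nat) (alpha beta : R) (Sigma : 'M[R]_p)
  (X : 'I_n -> T -> 'M[R]_p) :
  0 < beta -> (p%:R - 1) / 2 < alpha -> posdef Sigma ->
  mx_indep P X ->
  (forall l, has_mx_pdf P (X l) (mgamma_pdf alpha beta Sigma)) ->
  let Xbar := mx_mean X in
  let mu := (alpha * beta) *: Sigma in
  let bound := fun z : 'M[R]_p =>
    (powR (expR 1 / (alpha * beta)) (p%:R * alpha) *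
     powR (\det z / \det Sigma) alpha *
     expR (- (beta^-1 * \tr (invmx Sigma *m z)))) ^+ n in
  [/\ (forall z, posdef z -> mx_succ z mu ->
         (P [set t | mx_succ (Xbar t) z] <= (bound z)%:E)%E),
      (forall z, posdef z -> mx_prec z mu ->
         (P [set t | mx_prec (Xbar t) z] <= (bound z)%:E)%E),
      (forall rho, 1 <= rho ->
         (P [set t | mx_succ (Xbar t) (rho *: mu)] <=
          (powR (rho * expR (1 - rho)) (n%:R * p%:R * alpha))%:E)%E)
    & (forall rho, 0 <= rho <= 1 ->
         (P [set t | mx_prec (Xbar t) (rho *: mu)] <=
          (powR (rho * expR (1 - rho)) (n%:R * p%:R * alpha))%:E)%E)].
Proof.
move=> beta0 alpha_gt pSigma indepX pdfX Xbar mu bound.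
have mbar := measurable_mx_mean pdfX.
have mbarB (z : 'M[R]_p) i j : measurable_fun setT (fun t => (Xbar t - z) i j).
  rewrite (_ : (fun t => _) = (fun t => Xbar t i j - z i j)).
    by apply: measurable_funB; [exact: mbar|exact: measurable_cst].
  by apply/funext => t; rewrite mxE [(- z) i j]mxE.
have msucc z : measurable [set t | mx_succ (Xbar t) z].
  exact: measurable_posdef (mbarB z).
have mprec z : measurable [set t | mx_prec (Xbar t) z].
  apply: measurable_posdef => i j.
  rewrite (_ : (fun t => _) = (fun t => - (Xbar t - z) i j)).
    by apply: measurableT_comp => //; exact: mbarB.
  by apply/funext => t; rewrite -opprB mxE.
have le1 (E : set T) (b : R) : measurable E -> b = 1 -> (P E <= b%:E)%E.
  by move=> mE ->; exact: probability_le1.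
(* For [p = 0] the hypothesis only gives [alpha > - 1 / 2]. Determinants are [1] and traces [0], so
   every bound equals [1]; for [n = 0] likewise, as an empty power. *)
have [p0|p0] := posnP p.
  have bound1 z : bound z = 1.
    rewrite /bound; move: z Sigma {pSigma pdfX mu bound}; rewrite p0 => z S.
    rewrite mul0r powRr0 !det_mx00 divr1 powR1 mul1r.
    by rewrite /mxtrace big_ord0 mulr0 oppr0 expR0 mul1r expr1n.
  by split=> *; apply: le1 => //; rewrite p0 mulr0 mul0r powRr0.
have [n0|n0] := posnP n.
  have bound1 z : bound z = 1 by rewrite /bound n0 expr0.
  by split=> *; apply: le1 => //; rewrite n0 !mul0r powRr0.
have alpha0 : 0 < alpha.
  by apply: le_lt_trans alpha_gt; rewrite divr_ge0// subr_ge0 ler1n.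
have ab0 : 0 < alpha * beta by rewrite mulr_gt0.
have pmu : posdef mu by exact: posdefZ.
(* In this form the sign of the tilt follows from comparing [z] with [mu], inversion being
   antitone. *)
have tiltE z : tilt alpha beta Sigma z = alpha *: (invmx mu - invmx z).
  rewrite /tilt /mu invmxZ ?scalerBr ?scalerA; last first.
    by rewrite unitmxZ ?posdef_unitmx// unitfE gt_eqF.
  by congr (_ *: _ - _); field; rewrite !gt_eqF.
have succ z : posdef z -> mx_succ z mu ->
    (P [set t | mx_succ (Xbar t) z] <= (bound z)%:E)%E.
  move=> pz zmu; apply: (probability_le_chernoff_base alpha0 beta0 n0 pSigma
    indepX pdfX) => //.
  move=> t tz.
  rewrite tiltE -scalemxAl mxtraceZ mulr_ge0 ?(ltW alpha0)//.
  by apply: trace_mulmx_ge0 => // v; exact: qform_invmxB_ge0.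
have prec z : posdef z -> mx_prec z mu ->
    (P [set t | mx_prec (Xbar t) z] <= (bound z)%:E)%E.
  move=> pz zmu; apply: (probability_le_chernoff_base alpha0 beta0 n0 pSigma
    indepX pdfX) => //.
  move=> t tz.
  rewrite tiltE -scalemxAl mxtraceZ mulr_ge0 ?(ltW alpha0)//.
  (* Below the mean both factors have the opposite sign, so both are negated. *)
  rewrite -opprB mulNmx -mulmxN opprB.
  by apply: trace_mulmx_ge0 => // v; exact: qform_invmxB_ge0.
have bound_rho rho : 0 < rho ->
    bound (rho *: mu) = (rho * expR (1 - rho)) `^ (n%:R * p%:R * alpha).
  by move=> rho0; exact: chernoff_base_scaled_mean.
split => // rho.
  (* At [rho = 1] the matrix is [mu] itself, not strictly above it, but the bound is then [1]. *)
  rewrite le_eqVlt => /predU1P[<-|rho1].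
    by apply: le1 => //; rewrite subrr expR0 mulr1 powR1.
  have rho0 : 0 < rho by exact: lt_trans rho1.
  rewrite -bound_rho//; apply: succ; first exact: posdefZ.
  rewrite /mx_succ -{2}[mu]scale1r -scalerBl; apply: posdefZ => //.
  by rewrite subr_gt0.
have prec_rho r : 0 < r < 1 -> (P [set t | mx_prec (Xbar t) (r *: mu)] <=
    ((r * expR (1 - r)) `^ (n%:R * p%:R * alpha))%:E)%E.
  move=> /andP[r0 r1].
  rewrite -bound_rho//; apply: prec; first exact: posdefZ.
  rewrite /mx_prec -{1}[mu]scale1r -scalerBl; apply: posdefZ => //.
  by rewrite subr_gt0.
case/andP; rewrite le_eqVlt => /predU1P[<- _|rho0]; last first.
  rewrite le_eqVlt => /predU1P[->|rho1].
    by apply: le1 => //; rewrite subrr expR0 mulr1 powR1.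
  by apply: prec_rho; rewrite rho0.
(* At [rho = 0] the matrix is zero, hence not positive definite, and the bound is [0]. The event
   lies in the event for every [r] in []0, 1[], whose bound tends to [0] with [r]. *)
set q := n%:R * p%:R * alpha.
have q0 : 0 < q by rewrite !mulr_gt0 ?ltr0n.
rewrite mul0r powR0 ?gt_eqF//; apply/lee_addgt0Pr => e e0; rewrite add0e.
pose dlt := Num.min e 1.
have dlt0 : 0 < dlt by rewrite lt_min e0 ltr01.
(* [s] solves [q * (s + 1) = ln dlt], so the bound at [r], whose logarithm is [q * (s + (1 - r))],
   is at most [dlt]. Capping [dlt] at [1] makes [s] negative and so [r < 1]. *)
pose s := ln dlt / q - 1; pose r := expR s.
have s0 : s < 0.
  rewrite subr_lt0 (le_lt_trans _ ltr01)//.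
  by rewrite mulr_le0_ge0 ?invr_ge0 ?(ltW q0)// ln_le0// ge_min lexx orbT.
have r01 : 0 < r < 1 by rewrite expR_gt0 -expR0 ltr_expR.
have sub : [set t | mx_prec (Xbar t) (0 *: mu)] `<=`
    [set t | mx_prec (Xbar t) (r *: mu)].
  move=> t /=; rewrite /mx_prec scale0r => pX.
  rewrite -[_ - _]add0r addrCA; apply: posdefD => //.
  by apply: posdefZ => //; case/andP: r01.
apply: le_trans (le_measure _ _ _ sub) _; rewrite ?inE//.
apply: le_trans (prec_rho _ r01) _.
rewrite lee_fin powR_expR_ln ?mulr_gt0 ?expR_gt0// -expRD expRK.
apply: (@le_trans _ _ dlt); last by rewrite ge_min lexx.
rewrite -[leRHS]lnK ?posrE// ler_expR.
have -> : ln dlt = q * (s + 1) by rewrite /s subrK mulrC divfK ?gt_eqF.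
by rewrite ler_pM2l// lerD2l gerBl expR_ge0.
Qed.
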